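(* Let $\beta>0$ and $N_0>0$ be real constants, and let $\nu\ge 0$ and $\eta\ge 0$ be real constants. For $P>0$ and $B>0$ define $$\mathrm{EE}=\frac{B\log_2\left(1+\frac{P\beta}{BN_0}\right)}{P+\nu B+\eta B\log_2\left(1+\frac{P\beta}{BN_0}\right)}.$$ Then $\mathrm{EE}$ is maximized for any values of $P$ and $B$ such that $$\frac{P}{B}=N_0\,\frac{e^{x}-1}{\beta},\qquad\text{where}\qquad x=W\left(\frac{\beta\nu}{N_0e}-\frac1e\right)+1.$$
   Context: $W(\cdot)$ denotes the Lambert $W$ function (principal branch): for real $t\ge -1/e$, $W(t)$ is the unique real number $w\ge -1$ with $we^{w}=t$. Here $e$ is Euler's number. Interpretation: $P$ is the transmit power, $B$ the bandwidth, $\beta=|h|^2$ the channel gain of a deterministic single-antenna channel $h\in\mathbb{C}$ without interference, $N_0$ the noise power spectral density, $\nu$ and $\eta$ hardware-characterizing constants ($\nu B$ models the energy consumption of converters and baseband processing of samples, and the term with $\eta$ models that of data encoding/decoding), and $\mathrm{EE}$ the energy efficiency (data rate divided by energy consumption per unit time). $P$ and $B$ are the design variables; the other quantities are fixed. *)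

(* Defs.v *)
From Stdlib Require Import Reals Lra ClassicalEpsilon.
Open Scope R_scope.

(* Principal branch of the Lambert W function. The value is meaningful only for
   [- / exp 1 <= t], where the description picks out exactly one real number
   ([lambertW_spec], [lambertW_unique]). *)
Definition lambertW (t : R) : R :=
  epsilon (inhabits 0) (fun w : R => -1 <= w /\ w * exp w = t).

Lemma mul_exp_lt (a b : R) : -1 <= a -> a < b -> a * exp a < b * exp b.
Proof.
intros ha hab.
assert (hE : exp a = exp b * exp (a - b)).
{ rewrite <- exp_plus. f_equal. ring. }
assert (hb := exp_pos b).
assert (hd : 1 + (a - b) < exp (a - b)) by (apply exp_ineq1; lra).
assert (hd1 : exp (a - b) < 1) by (rewrite <- exp_0; apply exp_increasing; lra).
rewrite hE.
replace (a * (exp b * exp (a - b))) with (a * exp (a - b) * exp b) by ring.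
apply Rmult_lt_compat_r; [exact hb|].
destruct (Rle_or_lt 0 a); nra.
Qed.

Lemma lambertW_unique (t w1 w2 : R) :
  -1 <= w1 -> w1 * exp w1 = t -> -1 <= w2 -> w2 * exp w2 = t -> w1 = w2.
Proof.
intros h1 e1 h2 e2.
destruct (Rtotal_order w1 w2) as [h | [h | h]]; [| exact h |].
- assert (hlt := mul_exp_lt w1 w2 h1 h). lra.
- assert (hlt := mul_exp_lt w2 w1 h2 h). lra.
Qed.

Lemma lambertW_spec (t : R) :
  - / exp 1 <= t -> -1 <= lambertW t /\ lambertW t * exp (lambertW t) = t.
Proof.
intros ht. unfold lambertW. apply epsilon_spec.
assert (hm : -1 * exp (-1) = - / exp 1).
{ replace (-1) with (- (1)) at 2 by lra. rewrite exp_Ropp. ring. }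
destruct (Req_dec t (- / exp 1)) as [-> | hne].
{ exists (-1). split; [lra | exact hm]. }
assert (hcont : continuity (fun w => w * exp w - t)) by
  (apply derivable_continuous; reg).
assert (hinv : / exp 1 < 1).
{ rewrite <- exp_Ropp, <- exp_0. apply exp_increasing. rewrite exp_0. lra. }
assert (hup : 1 + (t + 1) <= exp (t + 1)) by apply exp_ineq1_le.
destruct (IVT (fun w => w * exp w - t) (-1) (t + 1) hcont) as [w [hw hw0]].
- lra.
- rewrite hm. lra.
- nra.
- exists w. split; [apply hw | lra].
Qed.

(* Shannon capacity, in bits per second, for transmit power [P], bandwidth [B],
   channel gain [beta] and noise power spectral density [N0]. *)
Definition rate (beta N0 P B : R) : R :=
  B * Rlog 2 (1 + P * beta / (B * N0)).

(* Data rate divided by energy consumption per unit time: [nu * B] accounts for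
   converters and baseband processing, [eta * rate] for encoding and decoding. *)
Definition EE (beta N0 nu eta P B : R) : R :=
  rate beta N0 P B / (P + nu * B + eta * rate beta N0 P B).

(* Main.v *)
Require Import Defs.
From Stdlib Require Import Reals Lra.
Open Scope R_scope.

(* In terms of y = ln (1 + P beta / (B N0)), EE depends on P and B only through
   y.  With c = beta nu / N0, maximizing EE over y > 0 amounts to minimizing
   (exp y - 1 + c) / y.  The defining equation of W gives
   (x - 1) exp x = c - 1, so the minimum (exp x - 1 + c) / x equals exp x, and
   minimality at x is the tangent line inequality 1 + (y - x) <= exp (y - x). *)

Lemma ln2_pos : 0 < ln 2.
Proof. rewrite <- ln_1. apply ln_increasing; lra. Qed.

Lemma snr_pos (beta N0 P B : R) :
  0 < beta -> 0 < N0 -> 0 < P -> 0 < B -> 0 < P * beta / (B * N0).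
Proof.
intros hbeta hN0 hP hB.
apply Rdiv_lt_0_compat; apply Rmult_lt_0_compat; assumption.
Qed.

(** Multiply numerator and denominator by [ln 2 / B]; then [P / B = N0 / beta * (exp y - 1)]
    eliminates both design variables. *)
Lemma EE_ln_snr (beta N0 nu eta P B : R) :
  0 < beta -> 0 < N0 -> 0 <= nu -> 0 <= eta -> 0 < P -> 0 < B ->
  let y := ln (1 + P * beta / (B * N0)) in
  EE beta N0 nu eta P B =
    y / (ln 2 * N0 / beta * (exp y - 1 + beta * nu / N0) + eta * y).
Proof.
intros hbeta hN0 hnu heta hP hB y.
assert (hl := ln2_pos).
assert (hs := snr_pos beta N0 P B hbeta hN0 hP hB).
assert (hy : 0 < y) by (unfold y; rewrite <- ln_1; apply ln_increasing; lra).
assert (hey : exp y = 1 + P * beta / (B * N0)) by (apply exp_ln; lra).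
rewrite hey. unfold EE, rate, Rlog. fold y.
(* These signs let [nra] show that the denominators cleared by [field] are nonzero. *)
assert (0 < ln 2 * P) by (apply Rmult_lt_0_compat; lra).
assert (0 <= ln 2 * nu * B) by (repeat apply Rmult_le_pos; lra).
assert (0 <= eta * y * B) by (repeat apply Rmult_le_pos; lra).
field. repeat split; nra.
Qed.

(** By the hypothesis, [exp x - 1 + c = x * exp x], so this is the tangent inequality times
    [x * exp x]. The cross-multiplied form also covers [x = 0]. *)
Lemma exp_tangent_ratio (c x y : R) :
  0 <= x -> (x - 1) * exp x = c - 1 ->
  y * (exp x - 1 + c) <= x * (exp y - 1 + c).
Proof.
intros hx hc.
assert (ht : 1 + (y - x) <= exp (y - x)) by apply exp_ineq1_le.
assert (hy : exp y = exp x * exp (y - x)) by (rewrite <- exp_plus; f_equal; ring).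
assert (hp : 0 <= x * exp x) by (apply Rmult_le_pos; [| left; apply exp_pos]; lra).
assert (hm := Rmult_le_compat_l _ _ _ hp ht).
replace c with ((x - 1) * exp x + 1) by lra.
rewrite hy. lra.
Qed.

(** [0 <= c] puts the argument [(c - 1) / e] in the domain of W; multiplying
    [w * exp w = (c - 1) / e] by [e], with [w = x - 1], gives the equation. *)
Lemma lambertW_shifted (c : R) :
  0 <= c ->
  let x := lambertW (c / exp 1 - 1 / exp 1) + 1 in
  0 <= x /\ (x - 1) * exp x = c - 1.
Proof.
intros hc x.
assert (he := exp_pos 1).
assert (hce : 0 <= c / exp 1).
{ apply Rmult_le_pos; [| left; apply Rinv_0_lt_compat]; assumption. }
destruct (lambertW_spec (c / exp 1 - 1 / exp 1)) as [hw hweq]; [lra |].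
unfold x. split; [lra |].
rewrite exp_plus.
replace (lambertW (c / exp 1 - 1 / exp 1) + 1 - 1)
  with (lambertW (c / exp 1 - 1 / exp 1)) by ring.
rewrite <- Rmult_assoc, hweq. field. lra.
Qed.

Theorem theorem1 (beta N0 nu eta : R)
    (hbeta : 0 < beta) (hN0 : 0 < N0) (hnu : 0 <= nu) (heta : 0 <= eta) :
  let x := lambertW (beta * nu / (N0 * exp 1) - 1 / exp 1) + 1 in
  forall P B : R, 0 < P -> 0 < B ->
    P / B = N0 * ((exp x - 1) / beta) ->
    forall P' B' : R, 0 < P' -> 0 < B' ->
      EE beta N0 nu eta P' B' <= EE beta N0 nu eta P B.
Proof.
intros x P B hP hB hPB P' B' hP' hB'.
set (c := beta * nu / N0).
assert (hc : 0 <= c).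
{ apply Rmult_le_pos; [apply Rmult_le_pos | left; apply Rinv_0_lt_compat]; lra. }
assert (hx : 0 <= x /\ (x - 1) * exp x = c - 1).
{ unfold x. replace (beta * nu / (N0 * exp 1)) with (c / exp 1).
  - apply lambertW_shifted, hc.
  - unfold c. assert (he := exp_pos 1). field. lra. }
clearbody x. destruct hx as [hx0 hxc].
rewrite !EE_ln_snr by assumption. fold c.
assert (hs := snr_pos beta N0 P B hbeta hN0 hP hB).
assert (hs' := snr_pos beta N0 P' B' hbeta hN0 hP' hB').
assert (hsx : P * beta / (B * N0) = exp x - 1).
{ replace (P * beta / (B * N0)) with (P / B * (beta / N0)) by (field; lra).
  rewrite hPB. field. lra. }
(* As [P] is positive, [hs] becomes [0 < exp x - 1], which keeps the denominator at [x] positive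
   even if [c = 0]. *)
rewrite hsx in *.
replace (1 + (exp x - 1)) with (exp x) by ring. rewrite ln_exp.
set (y := ln (1 + P' * beta / (B' * N0))).
assert (hy : 0 < y) by (unfold y; rewrite <- ln_1; apply ln_increasing; lra).
assert (hey : 1 < exp y) by (rewrite <- exp_0; apply exp_increasing, hy).
assert (hk : 0 < ln 2 * N0 / beta).
{ apply Rdiv_lt_0_compat; [apply Rmult_lt_0_compat; [apply ln2_pos |] |]; lra. }
set (k := ln 2 * N0 / beta) in *.
assert (hratio := exp_tangent_ratio c x y hx0 hxc).
assert (hkratio := Rmult_le_compat_l k _ _ (Rlt_le _ _ hk) hratio).
assert (hdx : 0 < k * (exp x - 1 + c) + eta * x).
{ apply Rplus_lt_le_0_compat; [apply Rmult_lt_0_compat | apply Rmult_le_pos]; lra. }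
assert (hdy : 0 < k * (exp y - 1 + c) + eta * y).
{ apply Rplus_lt_le_0_compat; [apply Rmult_lt_0_compat | apply Rmult_le_pos]; lra. }
(* After cross-multiplication the terms [eta * x * y] cancel, leaving [hkratio]. *)
apply Rmult_le_reg_r with (1 := hdx).
apply Rmult_le_reg_r with (1 := hdy).
field_simplify; lra.
Qed.
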